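(* Suppose $f:\mathbb{R}\to\mathbb{R}$ is bounded, measurable and differentiable, and let $$\mathcal{B}=\{t\in\mathbb{R}:\ \text{for all } x\in\mathbb{R},\ f(x)=t \Rightarrow f'(x)\neq 0\}.$$ Let $\tilde f^{\mathrm{FS}}$ be the function obtained by applying Fourier smoothing (with parameter $\sigma>0$) to $f$. Then for every $t\in\mathcal{B}$ such that the set $A_t:=\{x: f(x)=t,\ f'(x)\neq 0\}$ is finite, the set $B_t:=\{x:\tilde f^{\mathrm{FS}}(x)=t\}$ satisfies $$\# B_t\ \le\ \# A_t ,$$ where $\#$ denotes cardinality. Namely, the number of disconnected intervals of $B_t$ is less than or equal to that of $A_t$.
   Context: Fourier smoothing with parameter $\sigma>0$: take the Fourier transform $\int_{\mathbb{R}}f(y)e^{-2\pi i yw}\,dy$, multiply it by the Gaussian low-pass filter $H_\sigma(w)=e^{-2\pi^2\sigma^2w^2}$, and apply the inverse Fourier transform. Equivalently (and this is the meaning for general bounded measurable $f$), $\tilde f^{\mathrm{FS}}=\phi_\sigma * f$, i.e. $\tilde f^{\mathrm{FS}}(x)=\int_{\mathbb{R}}\phi_\sigma(x-s)f(s)\,ds$, where $\phi_\sigma(u)=\frac{1}{\sqrt{2\pi}\,\sigma}e^{-u^2/(2\sigma^2)}$. *)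

(* Defs.v *)
From HB Require Import structures.
From mathcomp Require Import all_boot all_order all_algebra.
From mathcomp Require Import all_classical all_reals all_analysis.
Set Implicit Arguments.
Unset Strict Implicit.
Unset Printing Implicit Defensive.
Import Order.TTheory GRing.Theory Num.Theory.
Import numFieldNormedType.Exports.

Local Open Scope classical_set_scope.
Local Open Scope ring_scope.

Definition gauss_kernel (R : realType) (sigma u : R) : R := normal_pdf 0 sigma u.

Lemma gauss_kernelE (R : realType) (sigma u : R) : 0 < sigma ->
  gauss_kernel sigma u =
    (Num.sqrt (2 * pi) * sigma)^-1 * expR (- (u ^+ 2 / (2 * sigma ^+ 2))).
Proof.
move=> s0; rewrite /gauss_kernel normal_pdfE ?gt_eqF//.
rewrite /normal_peak /normal_fun subr0 mulNr -(mulr_natl (sigma ^+ 2)).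
congr (_^-1 * _).
by rewrite -mulr_natl mulrCA mulrC sqrtrM ?mulr_ge0 ?pi_ge0// sqrtr_sqr gtr0_norm.
Qed.

(* [Rintegral] is 0 when the integral is infinite or undefined; for bounded
   measurable [f] and [sigma > 0] the integrand is Lebesgue integrable. *)
Definition fourier_smoothing (R : realType) (sigma : R) (f : R -> R) (x : R) : R :=
  \int[lebesgue_measure]_s (gauss_kernel sigma (x - s) * f s).

Definition regular_values (R : realType) (f : R -> R) : set R :=
  [set t | forall x, f x = t -> derive1 f x != 0].

Definition transversal_level_set (R : realType) (f : R -> R) (t : R) : set R :=
  [set x | f x = t /\ derive1 f x != 0].

Definition level_set (R : realType) (f : R -> R) (t : R) : set R :=
  [set x | f x = t].

(* The maximal intervals of [A]: connected subsets of the line are intervals. *)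
Definition components (R : realType) (A : set R) : set (set R) :=
  connected_component A @` A.

(* Main.v *)
(* Up to a positive factor, the value at [x] of the smoothing of [f], minus [t],
   is the bilateral Laplace transform at [x / sigma^2] of [h], the product of
   a Gaussian weight and [f - t].  If [a_1, ..., a_n] are the zeros of [f - t],
   all of them simple, then [f - t] is the product of the [s - a_i] and of a
   continuous function without zeros, so that [h(s) * prod_i (s - a_i)] has
   constant sign almost everywhere.  The Laplace transform [L h] of such an [h]
   has at most [n] zeros: the derivative of [exp (- a_1 x) * L h x] is
   [exp (- a_1 x) * L k x] with [k(s) = (s - a_1) * h(s)], and [k] satisfies the
   hypothesis for the [n - 1] points [a_2, ..., a_n], so that Rolle's theorem
   and induction on [n] conclude. *)
Require Import Defs.
From HB Require Import structures.
From mathcomp Require Import all_boot all_order all_algebra.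
From mathcomp Require Import all_classical all_reals all_analysis.
From mathcomp Require Import measurable_realfun ring lra.
Import Order.TTheory GRing.Theory Num.Theory.
Import numFieldNormedType.Exports.
Local Open Scope classical_set_scope.
Local Open Scope ring_scope.

(** * Rolle's theorem along an increasing list of zeros *)

Lemma rolle_zeros (R : realType) (F : R -> R) (x : R) (s : seq R) :
  (forall y, derivable F y 1) -> path <%R x s -> F x = 0 ->
  (forall y, y \in s -> F y = 0) ->
  exists2 z : seq R, size z = size s &
    path <%R x z /\ (forall y, y \in z -> derive1 F y = 0).
Proof.
move=> dF; elim: s x => [|y s IHs] x /=; first by exists [::].
move=> /andP[xy ys] Fx Fs.
have Fy : F y = 0 by apply: Fs; rewrite mem_head.
have [|z sz [yz Fz]] := IHs y ys Fy.
  by move=> w ws; apply: Fs; rewrite inE ws orbT.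
have [|||c] := @Rolle _ F x y xy; last 1 first.
- rewrite in_itv/= => /andP[xc cy] [_ dFc].
  (* [c] lies strictly between [x] and [y], while all of [z] lies beyond [y], so [c :: z] is still
     increasing. *)
  exists (c :: z); first by rewrite /= sz.
  rewrite /= xc; split.
    by case: z yz {Fz sz} => //= w z /andP[yw ->]; rewrite (lt_trans cy).
  by move=> w; rewrite inE => /predU1P[->|/Fz//]; rewrite derive1E.
- by move=> w _; exact: dF.
- by apply: derivable_within_continuous => w _; exact: dF.
- by rewrite Fx Fy.
Qed.

(** * Bilateral Laplace transform: derivative and number of zeros *)

Definition laplace {R : realType} (h : R -> R) (x : R) : R :=
  \int[lebesgue_measure]_s (expR (x * s) * h s).

Definition exp_integrable {R : realType} (h : R -> R) :=
  forall x : R, (@lebesgue_measure R).-integrable [set: R]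
    (EFin \o (fun s => expR (x * s) * h s)).

Lemma exp_integrable_measurable (R : realType) (h : R -> R) :
  exp_integrable h -> measurable_fun [set: R] h.
Proof.
move=> /(_ 0)/measurable_int/measurable_EFinP.
by under eq_fun do rewrite mul0r expR0 mul1r.
Qed.

Lemma integrable_normD (d : measure_display) (T : measurableType d) (R : realType)
    (mu : {measure set T -> \bar R}) (D : set T) (F G : T -> R) :
  measurable D -> mu.-integrable D (EFin \o F) -> mu.-integrable D (EFin \o G) ->
  mu.-integrable D (EFin \o (fun s => `|F s| + `|G s|)).
Proof.
move=> mD iF iG.
by apply: (integrableD mD (integrable_abse iF) (integrable_abse iG)).
Qed.

(** The factor [expR (b * s) + expR (- (b * s))] only shifts the parameter [x] to [x + b] and
    [x - b], where [k] is integrable too. *)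
Lemma exp_integrable_le (R : realType) (h k : R -> R) (b : R) :
  measurable_fun [set: R] h -> exp_integrable k ->
  (forall s, `|h s| <= (expR (b * s) + expR (- (b * s))) * `|k s|) ->
  exp_integrable h.
Proof.
move=> mh ik hk x.
have mexp : measurable_fun [set: R] (fun s => expR (x * s)).
  by apply: measurableT_comp => //; exact: measurable_funM.
apply: (@le_integrable _ _ _ (@lebesgue_measure R) _ measurableT
  (EFin \o (fun s => expR (x * s) * h s))
  (EFin \o (fun s => `|expR ((x + b) * s) * k s| + `|expR ((x - b) * s) * k s|))).
- by apply/measurable_EFinP; exact: measurable_funM.
- move=> s _; rewrite lee_fin [leRHS]ger0_norm ?addr_ge0// !normrM.
  rewrite !(ger0_norm (expR_ge0 _)).
  rewrite -mulrDl [(x + b) * s]mulrDl [(x - b) * s]mulrBl !expRD.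
  by rewrite -mulrDr -mulrA ler_pM2l ?expR_gt0//.
- by apply: integrable_normD => //; exact: ik.
Qed.

Lemma normr_le_expRD (R : realType) (s : R) : `|s| <= expR s + expR (- s).
Proof.
have := expR_ge1Dx s; have := expR_ge1Dx (- s).
by have := expR_ge0 s; have := expR_ge0 (- s); case: ler0P; lra.
Qed.

Lemma exp_integrableXl (R : realType) (h : R -> R) :
  exp_integrable h -> exp_integrable (fun s => s * h s).
Proof.
move=> ih; apply: (@exp_integrable_le _ _ h 1) => //.
  by apply: measurable_funM => //; exact: exp_integrable_measurable.
move=> s; rewrite normrM ler_wpM2r// mul1r; exact: normr_le_expRD.
Qed.

(** Differentiation under the integral sign, with domination for parameters in the interval of
    radius 1 around [x]. *)
Lemma is_derive_laplace (R : realType) (h : R -> R) (x : R) :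
  exp_integrable h -> is_derive x 1 (laplace h) (laplace (fun s => s * h s) x).
Proof.
move=> ih.
have isd (y s : R) : is_derive y 1 (fun z : R => expR (z * s) * h s)
    (expR (y * s) * (s * h s)).
  pose p : R -> R := fun z => s * z.
  have -> : (fun z : R => expR (z * s) * h s) = (h s) \*: (expR \o p).
    by apply/funext => z /=; rewrite /p mulrC (mulrC s).
  apply: is_derive_eq.
  by rewrite /= /p -![_ *: _]/(_ * _) (mulrC y); ring.
have d1 : partial1of2 (fun (z s : R) => expR (z * s) * h s) =
    (fun y s => expR (y * s) * (s * h s)).
  apply/funext => y; apply/funext => s; rewrite partial1of2E.
  by have /@derive_val := isd y s.
pose k s := s * h s.
have ik : exp_integrable k by exact: exp_integrableXl.
(* For [y] within 1 of [x], [expR (y * s)] is at most its value at [x + 1] if [s >= 0] and at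
   [x - 1] if [s < 0]; the sum covers both cases. *)
pose G s := `|expR ((x + 1) * s) * k s| + `|expR ((x - 1) * s) * k s|.
have iG : (@lebesgue_measure R).-integrable [set: R] (EFin \o G).
  by apply: integrable_normD => //; exact: ik.
have Ix : `]x - 1, x + 1[%classic x by rewrite /= in_itv/=; apply/andP; split; lra.
have Gge0 s : 0 <= G s by rewrite addr_ge0.
have GP (y s : R) : `]x - 1, x + 1[%classic y -> setT s ->
    `|partial1of2 (fun (z s : R) => expR (z * s) * h s) y s| <= G s.
  rewrite /= in_itv/= d1 => /andP[y1 y2] _.
  rewrite /G -[s * h s]/(k s) !(normrM _ (k s)) -mulrDl ler_wpM2r//.
  rewrite !(ger0_norm (expR_ge0 _)).
  have [s0|s0] := leP 0 s.
  - rewrite (@le_trans _ _ (expR ((x + 1) * s))) ?lerDl ?expR_ge0//.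
    by rewrite ler_expR ler_wpM2r// ltW.
  - rewrite (@le_trans _ _ (expR ((x - 1) * s))) ?lerDr ?expR_ge0//.
    by rewrite ler_expR ler_wnM2r// ltW.
have dK (y s : R) : `]x - 1, x + 1[%classic y -> [set: R] s ->
    derivable (fun z : R => expR (z * s) * h s) y 1.
  by move=> _ _; have [] := isd y s.
have iK (y : R) : `]x - 1, x + 1[%classic y ->
    (@lebesgue_measure R).-integrable [set: R] (EFin \o (fun s => expR (y * s) * h s)).
  by move=> _; exact: ih.
have := @derivable_under_integral R _ _ (@lebesgue_measure R) _ _
  measurableT x _ _ Ix iK dK G Gge0 iG GP.
have := @differentiation_under_integral R _ _ (@lebesgue_measure R) _ _
  measurableT x _ _ Ix iK dK G Gge0 iG GP.
rewrite derive1E d1 => dL dL1.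
exact: DeriveDef.
Qed.

Lemma exp_integrableBl (R : realType) (h : R -> R) (a : R) :
  exp_integrable h -> exp_integrable (fun s => (s - a) * h s).
Proof.
move=> ih x.
have := integrableB measurableT (exp_integrableXl _ _ ih x)
  (integrableZl measurableT a (ih x)).
congr (integrable _ _ _); apply/funext => s /=.
by rewrite -EFinD; congr EFin; ring.
Qed.

Lemma laplaceBl (R : realType) (h : R -> R) (a x : R) : exp_integrable h ->
  laplace (fun s => (s - a) * h s) x =
  laplace (fun s => s * h s) x - a * laplace h x.
Proof.
move=> ih; rewrite /laplace -RintegralZl//.
rewrite -RintegralB//; last 2 first.
- exact: exp_integrableXl.
- exact: (integrableZl measurableT a (ih x)).
by apply: eq_Rintegral => s _; ring.
Qed.

Lemma exp_integrableZl (R : realType) (h : R -> R) (e : R) :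
  exp_integrable h -> exp_integrable (fun s => e * h s).
Proof.
move=> ih x; have := integrableZl measurableT e (ih x).
by congr (integrable _ _ _); apply/funext => s /=; rewrite -EFinM mulrCA.
Qed.

Lemma laplaceZl (R : realType) (h : R -> R) (e x : R) : exp_integrable h ->
  laplace (fun s => e * h s) x = e * laplace h x.
Proof.
move=> ih; rewrite /laplace -RintegralZl//.
by apply: eq_Rintegral => s _; rewrite mulrCA.
Qed.

(** If the integral vanished, the integrand, nonnegative almost everywhere, would be zero almost
    everywhere, although [h] is positive there. *)
Lemma laplace_neq0 (R : realType) (h : R -> R) (x : R) : exp_integrable h ->
  {ae (@lebesgue_measure R), forall s, 0 < h s} -> laplace h x != 0.
Proof.
move=> ih h0; apply/eqP => L0.
pose F s := expR (x * s) * h s.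
have mF : measurable_fun setT (EFin \o F) := measurable_int _ (ih x).
have iF : (\int[lebesgue_measure]_s (F s)%:E)%E = 0%E.
  by rewrite -[LHS]fineK ?[X in X%:E]L0// integrable_fin_num//; exact: ih.
have : (\int[lebesgue_measure]_s `|(EFin \o F) s|)%E = 0%E.
  rewrite -iF; apply: ae_eq_integral => //; first exact: measurableT_comp.
  apply: (@filterS _ _ (ae_filter_ringOfSetsType (@lebesgue_measure R)) _ _ _ h0).
  by move=> s hs _ /=; rewrite ger0_norm// mulr_ge0 ?expR_ge0// ltW.
move/(ae_eq_integral_abs (@lebesgue_measure R) measurableT mF).1 => F0.
(* The exceptional set would be the whole line, but [[0, 1]] has measure 1. *)
have : {ae (@lebesgue_measure R), forall s : R, False}.
  apply: (@filterS2 _ _ (ae_filter_ringOfSetsType (@lebesgue_measure R))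
    _ _ _ _ h0 F0) => s hs /(_ I) /= [] /eqP.
  by rewrite mulf_eq0 gt_eqF ?expR_gt0//= gt_eqF.
move=> [N [mN N0 sN]].
have : (lebesgue_measure ([set` `[0%R, 1%R]] : set R) <= lebesgue_measure N)%E.
  by rewrite le_measure ?inE// => y _; apply: sN.
by rewrite N0 lebesgue_measure_itv/= lte01 sube0 lee_fin ler10.
Qed.

(** [h] varies in the induction on [a]: each step moves one factor of the product into [h] and loses
    one zero to Rolle. Once the product is empty, [h] itself is positive almost everywhere and no
    zero is left. *)
Lemma laplace_zeros (R : realType) (a : seq R) (h : R -> R) (s : seq R) :
  exp_integrable h ->
  {ae (@lebesgue_measure R), forall s, 0 < h s * \prod_(b <- a) (s - b)} ->
  sorted <%R s -> (forall x, x \in s -> laplace h x = 0) -> (size s <= size a)%N.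
Proof.
elim: a h s => [|a l IHl] h s ih h0 ss Ls.
  case: s ss Ls => // x s _ Ls; have := Ls x; rewrite mem_head => /(_ isT)/eqP.
  apply: contraLR => _; apply: laplace_neq0 => //.
  apply: (@filterS _ _ (ae_filter_ringOfSetsType (@lebesgue_measure R)) _ _ _ h0).
  by move=> y; rewrite big_nil mulr1.
case: s ss Ls => // x s /= xs Ls.
pose F : R -> R := (expR \o ( *%R (- a))) * laplace h.
have F0 y : laplace h y = 0 -> F y = 0.
  by move=> Ly; rewrite -[F y]/(expR (- a * y) * laplace h y) Ly mulr0.
have dF (y : R) : is_derive y 1 F
    (expR (- a * y) * laplace (fun s => (s - a) * h s) y).
  have dL := @is_derive_laplace _ _ y ih.
  apply: is_derive_eq.
  by rewrite laplaceBl// /= -![_ *: _]/(_ * _); ring.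
have [||||z sz [xz Fz]] := @rolle_zeros _ F x s.
- by move=> y; have [] := dF y.
- by [].
- by rewrite F0// Ls// mem_head.
- by move=> y ys; rewrite F0// Ls// inE ys orbT.
rewrite ltnS -sz; apply: (IHl (fun s => (s - a) * h s)).
- exact: exp_integrableBl.
- apply: (@filterS _ _ (ae_filter_ringOfSetsType (@lebesgue_measure R)) _ _ _ h0).
  by move=> y; rewrite big_cons mulrCA mulrA.
- exact: path_sorted xz.
- move=> y /Fz; rewrite derive1E; have /@derive_val-> := dF y => /eqP.
  by rewrite mulf_eq0 gt_eqF ?expR_gt0//= => /eqP.
Qed.

(** * Dividing out a simple zero *)

Definition slope {R : realType} (g : R -> R) (a s : R) : R :=
  if s == a then derive1 g a else (g s - g a) / (s - a).

Lemma slopeM (R : realType) (g : R -> R) (a s : R) :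
  slope g a s * (s - a) = g s - g a.
Proof.
rewrite /slope; have [->|sa] := eqVneq s a; first by rewrite !subrr mulr0.
by rewrite divfK// subr_eq0.
Qed.

Lemma near_slope (R : realType) (g : R -> R) (a b : R) : b != a ->
  \forall s \near b, (g s - g a) / (s - a) = slope g a s.
Proof.
move=> ba; near=> s; rewrite /slope ifN//.
by near: s; apply: open_nbhs_nbhs; split; [exact: open_neq|].
Unshelve. all: by end_near. Qed.

(** At [a], continuity is the convergence of the difference quotient to the derivative; elsewhere
    the slope is locally a quotient of continuous functions. *)
Lemma continuous_slope (R : realType) (g : R -> R) (a : R) :
  continuous g -> derivable g a 1 -> continuous (slope g a).
Proof.
move=> cg dg b; have [->|ba] := eqVneq b a.
  apply/continuous_withinNshiftx; rewrite [slope g a a]/slope eqxx.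
  move: dg => /cvg_ex[l dl].
  have -> : derive1 g a = l.
    by rewrite derive1E; apply/cvg_lim.
  apply: cvg_trans dl; apply: near_eq_cvg; near=> h.
  have h0 : h != 0 by near: h; exact: nbhs_dnbhs_neq.
  by rewrite /= /slope -subr_eq0 addrK (negbTE h0) -![_ *: _]/(_ * _) mulr1 mulrC.
have ns := near_slope _ g _ _ ba.
rewrite /continuous_at /slope (negbTE ba).
apply: cvg_trans (near_eq_cvg ns) _.
apply: cvgM; first by apply: cvgB; [exact: cg|exact: cvg_cst].
by apply: cvgV; [rewrite subr_eq0|apply: cvgB; [exact: cvg_id|exact: cvg_cst]].
Unshelve. all: by end_near. Qed.

(** In the product rule, the term differentiating [1 / (s - a)] carries the factor [g b = 0]. Hence
    a simple zero [b] of [g] remains simple for the slope. *)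
Lemma is_derive_slope (R : realType) (g : R -> R) (a b : R) :
  b != a -> g a = 0 -> g b = 0 -> derivable g b 1 ->
  is_derive b 1 (slope g a) (derive1 g b / (b - a)).
Proof.
move=> ba ga gb dg; apply: near_eq_is_derive (near_slope _ g _ _ ba) _.
have dgb : is_derive b 1 g (derive1 g b) by apply: DeriveDef => //; rewrite derive1E.
pose d : R -> R := id - cst a.
have b0 : d b != 0 by rewrite subr_eq0.
have dd : is_derive b 1 d (1 - 0) by exact: is_deriveB.
have dV : is_derive b 1 (fun s => (d s)^-1) _ := is_deriveV b0 dd.
have -> : (fun s => (g s - g a) / (s - a)) = g * (fun s => (d s)^-1).
  by apply/funext => s; rewrite ga subr0.
apply: is_derive_eq.
by rewrite gb scale0r add0r -[LHS]/((b - a)^-1 * _) mulrC.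
Qed.

(** By the intermediate value theorem all values share the sign of [g 0], so [g 0] itself serves as
    [e]. *)
Lemma continuous_neq0_sign (R : realType) (g : R -> R) :
  continuous g -> (forall s, g s != 0) -> exists e : R, forall s, 0 < e * g s.
Proof.
move=> cg g0; exists (g 0) => s; rewrite ltNge; apply/negP => gs.
have ivt (a b : R) : a <= b -> g a * g b <= 0 -> False.
  move=> ab gab.
  have := @IVT _ g a b 0 ab; case.
  - exact: continuous_subspaceT.
  - rewrite ge_min le_max; case: (leP (g a) 0) gab (g0 a) (g0 b);
      by case: (leP (g b) 0) => //=; nra.
  - by move=> c _ gc; have := g0 c; rewrite gc eqxx.
have [s0|s0] := leP 0 s; first exact: ivt s0 gs.
by apply: (ivt s 0 (ltW s0)); rewrite mulrC.
Qed.

(** * Counting by lists, and components of finite sets *)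

Lemma card_le_seq (T : choiceType) (B : set T) (n : nat) :
  (forall s : seq T, uniq s -> (forall x, x \in s -> B x) -> (size s <= n)%N) ->
  (B #<= `I_n)%card.
Proof.
move=> Bn.
have [finB|infB] := pselect (finite_set B).
  have BE := fset_setK finB.
  rewrite -BE (card_le_eql (introT card_eq_fsetP erefl)) card_le_II.
  apply: Bn => // x xB; rewrite -BE//.
(* An infinite [B] would contain [n.+1] distinct points, against the bound. *)
have [X XB] := infinite_set_fset n.+1 infB.
rewrite ltnNge Bn// => x xX; exact: XB.
Qed.

(** A connected subset of [A] is an interval of measure 0, whereas two distinct points would span a
    segment of positive length. *)
Lemma finite_connected_component (R : realType) (A : set R) (x : R) :
  finite_set A -> A x -> connected_component A x = [set x].
Proof.
move=> finA Ax; apply/seteqP; split; last first.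
  by move=> _ ->; exact: connected_component_refl.
move=> y [C [Cx CA /connected_intervalP iC] Cy].
have C0 : lebesgue_measure C = 0.
  apply: countable_lebesgue_measure0; apply: finite_set_countable.
  exact: sub_finite_set finA.
have hC u v : C u -> C v -> u < v -> False.
  move=> Cu Cv uv.
  have : (lebesgue_measure ([set` `[u, v]] : set R) <= 0)%E.
    rewrite -C0 le_measure ?inE//; first exact: is_interval_measurable.
    by move=> z /=; rewrite in_itv/=; exact: iC.
  by rewrite lebesgue_measure_itv/= lte_fin uv -EFinB lee_fin subr_le0 leNgt uv.
rewrite /=; case: (ltgtP y x) => // yx; exfalso.
- exact: (hC y x).
- exact: (hC x y).
Qed.

(** * Sign of a function with finitely many simple zeros *)

Lemma product_sign (R : realType) (l : seq R) (g : R -> R) :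
  uniq l -> continuous g ->
  (forall a, a \in l -> [/\ g a = 0, derivable g a 1 & derive1 g a != 0]) ->
  (forall s, s \notin l -> g s != 0) ->
  exists e : R, forall s, s \notin l -> 0 < e * g s * \prod_(a <- l) (s - a).
Proof.
elim: l g => [|a l IHl] g /=.
  move=> _ cg _ g0; have [//||e eg] := @continuous_neq0_sign _ g.
    by move=> s; exact: g0.
  by exists e => s _; rewrite big_nil mulr1.
move=> /andP[al ul] cg gl g0.
have [ga dga dga0] := gl a (mem_head _ _).
have slope0 s : g s != 0 -> slope g a s != 0.
  move=> gs; have := slopeM _ g a s; rewrite ga subr0 => sE.
  by apply: contra_neq gs; rewrite -sE => ->; rewrite mul0r.
(* The slope at [a] keeps the other zeros simple and does not vanish at [a], where its value is the
   nonzero derivative. *)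
have [||||e eg] := IHl (slope g a) => //.
- exact: continuous_slope.
- move=> b bl; have ba : b != a by apply: contraNneq al => <-.
  have [gb dgb dgb0] : [/\ g b = 0, derivable g b 1 & derive1 g b != 0].
    by apply: gl; rewrite inE bl orbT.
  have dsb := is_derive_slope _ _ _ _ ba ga gb dgb.
  split.
  + by rewrite /slope (negbTE ba) ga gb subrr mul0r.
  + by case: dsb.
  + rewrite derive1E; have /@derive_val-> := dsb.
    by rewrite mulf_neq0// invr_eq0 subr_eq0.
- move=> s sl; have [->|sa] := eqVneq s a; first by rewrite /slope eqxx.
  by apply: slope0; apply: g0; rewrite inE negb_or sa.
- exists e => s; rewrite inE negb_or => /andP[sa sl].
  rewrite big_cons -[g s]subr0 -[X in g s - X]ga -slopeM.
  (* The factor [s - a] occurs once in [g] and once in the product; its square leaves the sign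
     unchanged, so the same [e] works. *)
  have -> : e * (slope g a s * (s - a)) * ((s - a) * \prod_(b <- l) (s - b)) =
    (s - a) ^+ 2 * (e * slope g a s * \prod_(b <- l) (s - b)) by ring.
  by rewrite mulr_gt0 ?eg// exprn_even_gt0//= subr_eq0.
Qed.

(** * Gaussian smoothing as a Laplace transform *)

Definition gauss_weight {R : realType} (sigma s : R) : R :=
  expR (- (s ^+ 2 / (2 * sigma ^+ 2))).

(** The part independent of [s] when the square is completed in the normal density of mean
    [sigma ^+ 2 * y]. *)
Definition tilt_factor {R : realType} (sigma y : R) : R :=
  normal_peak sigma * expR (- (sigma ^+ 2 * y ^+ 2 / 2)).

Lemma normal_pdf_tilt (R : realType) (sigma y s : R) : sigma != 0 ->
  normal_pdf (sigma ^+ 2 * y) sigma s =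
  tilt_factor sigma y * (expR (y * s) * gauss_weight sigma s).
Proof.
move=> s0; rewrite normal_pdfE// /normal_fun /tilt_factor.
rewrite -(mulrA (normal_peak sigma)) -!expRD.
by congr (_ * expR _); field.
Qed.

Lemma tilt_factor_neq0 (R : realType) (sigma y : R) : sigma != 0 ->
  tilt_factor sigma y != 0.
Proof. by move=> s0; rewrite gt_eqF// mulr_gt0 ?expR_gt0// normal_peak_gt0. Qed.

Lemma gauss_kernel_center (R : realType) (sigma x s : R) : sigma != 0 ->
  gauss_kernel sigma (x - s) = normal_pdf x sigma s.
Proof.
move=> s0; rewrite /gauss_kernel !normal_pdfE// /normal_fun.
by rewrite subr0 -[x - s]opprB sqrrN.
Qed.

Lemma integrable_normal_pdfM (R : realType) (sigma m : R) (g : R -> R) :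
  measurable_fun [set: R] g -> bounded_fun g ->
  (@lebesgue_measure R).-integrable [set: R]
    (EFin \o (fun s => normal_pdf m sigma s * g s)).
Proof.
move=> mg bg.
exact: (integrableMl measurableT (integrable_normal_pdf m sigma) mg bg).
Qed.

(** Multiplying the Gaussian weight by [expR (y * s)] gives a multiple of a shifted normal density,
    which stays integrable against a bounded function. *)
Lemma exp_integrable_gauss_weightM (R : realType) (sigma : R) (g : R -> R) :
  sigma != 0 -> measurable_fun [set: R] g -> bounded_fun g ->
  exp_integrable (fun s => gauss_weight sigma s * g s).
Proof.
move=> s0 mg bg y.
have := integrableZl measurableT (tilt_factor sigma y)^-1
  (integrable_normal_pdfM _ sigma (sigma ^+ 2 * y) _ mg bg).
congr (integrable _ _ _); apply/funext => s /=.
rewrite normal_pdf_tilt// -EFinM -(mulrA (tilt_factor sigma y)).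
by rewrite mulKf ?tilt_factor_neq0// mulrA.
Qed.

Lemma fourier_smoothing_laplace (R : realType) (sigma t y : R) (f : R -> R) :
  0 < sigma -> measurable_fun [set: R] f -> bounded_fun f ->
  fourier_smoothing sigma f (sigma ^+ 2 * y) - t =
  tilt_factor sigma y * laplace (fun s => gauss_weight sigma s * (f s - t)) y.
Proof.
move=> sigma_gt0 mf bf; have s0 : sigma != 0 by rewrite gt_eqF.
have mg : measurable_fun [set: R] (fun s => f s - t) by exact: measurable_funB.
have bg : bounded_fun (fun s => f s - t).
  exact: (bounded_funD bf (bounded_cst (- t) setT)).
have int1 : \int[lebesgue_measure]_s normal_pdf (sigma ^+ 2 * y) sigma s = 1 :> R.
  by rewrite /Rintegral integral_normal_pdf.
rewrite /laplace -RintegralZl//; last exact: exp_integrable_gauss_weightM.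
(* The normal density has mass 1, so [t] is the integral of [t] times the density and can join the
   other integral. *)
rewrite -[t in LHS]mulr1 -int1 -RintegralZl//; last exact: integrable_normal_pdf.
rewrite /fourier_smoothing -RintegralB//; last 2 first.
- under eq_fun do rewrite gauss_kernel_center//.
  exact: integrable_normal_pdfM.
- exact: (integrableZl measurableT t (integrable_normal_pdf _ _)).
apply: eq_Rintegral => s _.
by rewrite gauss_kernel_center// normal_pdf_tilt//; ring.
Qed.

(** * Comparison of the level sets and of their components *)

Lemma smoothing_level_le (R : realType) (f : R -> R) (sigma t : R) (l s : seq R) :
  0 < sigma -> bounded_fun f -> measurable_fun [set: R] f ->
  (forall x : R, derivable f x 1) -> regular_values f t ->
  uniq l -> level_set f t = [set` l] -> uniq s ->
  (forall x, x \in s -> level_set (fourier_smoothing sigma f) t x) ->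
  (size s <= size l)%N.
Proof.
move=> sigma_gt0 bf mf df treg ul fl us Bs.
have s0 : sigma != 0 by rewrite gt_eqF.
have flE x : (f x == t) = (x \in l).
  have -> : (x \in l) = `[<level_set f t x>] by rewrite fl; apply/idP/asboolP.
  by apply/eqP/asboolP.
pose g x := f x - t.
have dg (x : R) : is_derive x 1 g (derive1 f x - 0).
  have dfx : is_derive x 1 f (derive1 f x).
    by apply: DeriveDef => //; rewrite derive1E.
  exact: is_deriveB.
have [|||e eg] := @product_sign _ l g ul.
- move=> x; apply/differentiable_continuous/derivable1_diffP.
  by case: (dg x).
- move=> a; rewrite -flE => /eqP fa; split.
  + by rewrite /g fa subrr.
  + by case: (dg a).
  + by rewrite derive1E; have /@derive_val-> := dg a; rewrite subr0; exact: treg.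
- by move=> x; rewrite -flE subr_eq0.
pose h x := gauss_weight sigma x * g x.
have ih : exp_integrable h.
  apply: exp_integrable_gauss_weightM => //; first exact: measurable_funB.
  exact: (bounded_funD bf (bounded_cst (- t) setT)).
(* Dividing by [sigma ^+ 2] inverts the substitution [x = sigma ^+ 2 * y]; sorting supplies the
   increasing order needed for Rolle. *)
pose z := [seq x / sigma ^+ 2 | x <- sort <=%R s].
have -> : size s = size z by rewrite size_map size_sort.
(* The constant [e] turns constant sign into positivity, and zeros of the transform of [h] remain
   zeros. *)
apply: (@laplace_zeros _ l (fun x => e * h x)).
- exact: exp_integrableZl.
(* Positivity fails at most on the finite, hence null, set of points of [l]. *)
- have cl : countable [set` l] by apply: finite_set_countable; exact: finite_seq.
  exists [set` l]; split.
  + by apply: countable_measurable.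
  + by apply: countable_lebesgue_measure0.
  + move=> x /=; apply: contra_notP => /negP xl.
    have -> : e * h x * \prod_(b <- l) (x - b) =
      gauss_weight sigma x * (e * g x * \prod_(b <- l) (x - b)) by rewrite /h; ring.
    by rewrite mulr_gt0 ?expR_gt0// eg.
- apply: (homo_sorted (e := <%R)); last by rewrite sort_lt_sorted.
  by move=> x y xy; rewrite ltr_pM2r// invr_gt0 exprn_gt0.
- move=> y /mapP[x]; rewrite mem_sort => /Bs Bx ->{y}.
  have := fourier_smoothing_laplace _ _ t (x / sigma ^+ 2) _ sigma_gt0 mf bf.
  rewrite laplaceZl//.
  rewrite [sigma ^+ 2 * _]mulrC divfK ?sqrf_eq0// Bx subrr => /esym/eqP.
  by rewrite mulf_eq0 (negbTE (tilt_factor_neq0 _ _ _ _))//= => /eqP->; rewrite mulr0.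
Qed.

(** The components of [B] are an image of [B], and those of the finite set [A] are its singletons,
    as many as its points. *)
Lemma components_card_le (R : realType) (A B : set R) :
  finite_set A -> (B #<= A)%card -> (components B #<= components A)%card.
Proof.
move=> finA BA; apply: card_le_trans (card_image_le _ _) _.
apply: card_le_trans BA _; rewrite (card_le_eqr (inj_card_eq _))//.
move=> x y; rewrite !inE => Ax Ay.
rewrite !finite_connected_component// => xy.
by have : [set y] x by rewrite -xy.
Qed.

Theorem theorem4p2 (R : realType) (f : R -> R) (sigma : R)
    (sigma_gt0 : 0 < sigma)
    (f_bounded : bounded_fun f)
    (f_measurable : measurable_fun [set: R] f)
    (f_differentiable : forall x : R, derivable f x 1)
    (t : R) (t_regular : regular_values f t)
    (A_finite : finite_set (transversal_level_set f t)) :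
  (level_set (fourier_smoothing sigma f) t #<= transversal_level_set f t)%card /\
  (components (level_set (fourier_smoothing sigma f) t)
     #<= components (transversal_level_set f t))%card.
Proof.
(* Regularity of [t] makes every point of its level set transversal. *)
have transE : transversal_level_set f t = level_set f t.
  by apply/seteqP; split=> [x []|x fx] //; split=> //; exact: t_regular.
rewrite transE in A_finite *.
suff BA : (level_set (fourier_smoothing sigma f) t #<= level_set f t)%card.
  by split=> //; exact: components_card_le.
have AE := fset_setK A_finite.
rewrite -AE (card_le_eqr (introT card_eq_fsetP erefl)).
apply: card_le_seq => s us Bs.
apply: (smoothing_level_le _ _ _ _
  (finmap.enum_fset (fset_set (level_set f t)))) us Bs => //.
exact: finmap.fset_uniq.
Qed.
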